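(* Suppose $0<k_1<k_2$ and $\epsilon>0$. Let $\lambda_i=k_in+\frac{\epsilon\coth k_i}{4}t$ $(i=1,2)$ and let $\mu=g/f$ with $$f=\cosh2(k_1+k_2)\sinh^2(\lambda_1-\lambda_2)+\cosh2(k_1-k_2)\cosh^2(\lambda_1+\lambda_2)-\cosh2\lambda_1\cosh2\lambda_2,$$ $$g=\tfrac1\epsilon(\cosh2k_1-\cosh2k_2)(\sinh2k_1\cosh2\lambda_2-\sinh2k_2\cosh2\lambda_1).$$ Then, as $t\to\pm\infty$, $\mu$ has the following asymptotic behaviour. (1) ($k_1$-soliton) With $\lambda_1$ held fixed, as $t\to\pm\infty$ $\mu$ tends to a single-soliton profile (a function of $\lambda_1$) whose extremum (the unique maximum point of its modulus) lies on the trace $$n(t)=\pm\frac1{2k_1}\ln\frac{\sinh(k_2-k_1)}{\sinh(k_1+k_2)}-\frac{\epsilon\coth k_1}{4k_1}t,$$ with amplitude (value of the profile at the extremum) $$\frac{\sinh2k_1(\cosh2k_1-\cosh2k_2)}{2\epsilon\sinh(k_2-k_1)\sinh(k_1+k_2)},$$ speed $-\frac{\epsilon}{4k_1}\coth k_1$, and phase shift $\frac1{k_1}\ln\frac{\sinh(k_2-k_1)}{\sinh(k_1+k_2)}$. (2) ($k_2$-soliton) With $\lambda_2$ held fixed, as $t\to\pm\infty$ $\mu$ tends to a single-soliton profile (a function of $\lambda_2$) whose extremum (the unique maximum point of its modulus) lies on the trace $$n(t)=\mp\frac1{2k_2}\ln\frac{\sinh(k_2-k_1)}{\sinh(k_1+k_2)}-\frac{\epsilon\coth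 k_2}{4k_2}t,$$ with amplitude $$\frac{\sinh2k_2(\cosh2k_2-\cosh2k_1)}{2\epsilon\sinh(k_2-k_1)\sinh(k_1+k_2)},$$ speed $-\frac{\epsilon}{4k_2}\coth k_2$, and phase shift $-\frac1{k_2}\ln\frac{\sinh(k_2-k_1)}{\sinh(k_1+k_2)}$. In each formula the upper sign refers to $t\to+\infty$ and the lower sign to $t\to-\infty$.
   Context: Here $\mu(n,t)$ is the two-soliton solution of the nonlocal semi-discrete sine-Gordon equation $2(\mu(n+1,t)-\mu(n,t))'=\epsilon(\mu(n,t)+\mu(n+1,t))(1-2\omega')$, $e^{\epsilon(\omega(n,t)-\omega(n-1,t))}-1=\epsilon^2\mu(n,t)\mu(-n,-t)$ (prime $=\partial_t$), given by the displayed formula. For the asymptotic statement $n$ is treated as a real variable in this formula. ''With $\lambda_i$ held fixed, $t\to\pm\infty$'' means: substitute $n=(\lambda_i-\frac{\epsilon\coth k_i}{4}t)/k_i$ and let $t\to\pm\infty$ for each fixed real $\lambda_i$. The speed is the slope $dn/dt$ of the trace; the phase shift is the intercept of the trace for $t\to+\infty$ minus the intercept of the trace for $t\to-\infty$. *)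

(* Defs.v *)
(* Stdlib reals with Coquelicot *)
From Stdlib Require Import Reals.
From Coquelicot Require Import Coquelicot.
Open Scope R_scope.

Definition coth (x : R) : R := cosh x / sinh x.

Definition lambda (eps k n t : R) : R := k * n + eps * coth k / 4 * t.

Definition two_soliton_f (k1 k2 l1 l2 : R) : R :=
  cosh (2 * (k1 + k2)) * sinh (l1 - l2) ^ 2
  + cosh (2 * (k1 - k2)) * cosh (l1 + l2) ^ 2
  - cosh (2 * l1) * cosh (2 * l2).

Definition two_soliton_g (eps k1 k2 l1 l2 : R) : R :=
  1 / eps * (cosh (2 * k1) - cosh (2 * k2))
  * (sinh (2 * k1) * cosh (2 * l2) - sinh (2 * k2) * cosh (2 * l1)).

(* The site variable n is real. The value at a possible zero of f is
   irrelevant to the limits t -> +-oo. *)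
Definition two_soliton (eps k1 k2 n t : R) : R :=
  two_soliton_g eps k1 k2 (lambda eps k1 n t) (lambda eps k2 n t)
  / two_soliton_f k1 k2 (lambda eps k1 n t) (lambda eps k2 n t).

(* The real n at which lambda eps k n t = lam (for k <> 0). *)
Definition site_at (eps k lam t : R) : R := (lam - eps * coth k / 4 * t) / k.

(* With lambda held fixed, u tends to P (pointwise in lambda) as t -> T,
   where T is p_infty or m_infty. *)
Definition tends_to_profile (u : R -> R -> R) (eps k : R) (T : Rbar)
    (P : R -> R) : Prop :=
  forall lam : R, is_lim (fun t => u (site_at eps k lam t) t) T (P lam).

(* The one-soliton solution with parameter k of the nonlocal semi-discrete
   sine-Gordon equation is n, t |-> (sinh (2 k) / eps) / cosh (2 lambda);
   a profile is a nonzero multiple of a translate of this shape. *)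
Definition single_soliton_profile (P : R -> R) : Prop :=
  exists a c : R, a <> 0 /\ forall lam : R, P lam = a / cosh (2 * (lam - c)).

Definition unique_abs_max_point (P : R -> R) (x0 : R) : Prop :=
  forall x : R, x <> x0 -> Rabs (P x) < Rabs (P x0).

Definition asymptotic_soliton (u : R -> R -> R) (eps k : R) (T : Rbar)
    (trace : R -> R) (amplitude : R) : Prop :=
  exists P : R -> R,
    single_soliton_profile P /\
    tends_to_profile u eps k T P /\
    forall t : R,
      unique_abs_max_point P (lambda eps k (trace t) t) /\
      P (lambda eps k (trace t) t) = amplitude.

Definition has_speed (trace : R -> R) (v : R) : Prop :=
  forall t : R, is_derive trace t v.

(* Difference of the intercepts at t = 0 of the outgoing (t -> +oo) and
   incoming (t -> -oo) traces. *)
Definition phase_shift (trace_out trace_in : R -> R) : R :=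
  trace_out 0 - trace_in 0.

(* Main.v *)
(** In the frame of one soliton, with [l] its own phase held fixed, the other
    phase [m] runs off to infinity, because [coth k / k] is strictly decreasing
    in [k]. Up to the common factor [exp (2 |m|) / 4], the numerator tends to a
    constant and [f] to
    [2 sinh(k1+k2)^2 exp (-+ 2 l) + 2 sinh(k1-k2)^2 exp (+- 2 l)],
    a multiple of a translate of [cosh (2 l)]. The two formulas for [f] and [g]
    are invariant under exchanging the solitons and under changing the sign of
    both phases, so a single limit [m -> +oo] covers the four cases. *)
Require Import Defs.
From Stdlib Require Import Reals Lra.
From Coquelicot Require Import Coquelicot.
Open Scope R_scope.

(** * Elementary facts on hyperbolic functions *)

Lemma cosh_neg (x : R) : cosh (- x) = cosh x.
Proof. unfold cosh; rewrite Ropp_involutive; lra. Qed.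

Lemma sinh_neg (x : R) : sinh (- x) = - sinh x.
Proof. unfold sinh; rewrite Ropp_involutive; lra. Qed.

Lemma sinh_gt_0 (x : R) : 0 < x -> 0 < sinh x.
Proof. intros hx; rewrite <- sinh_0; now apply sinh_lt. Qed.

Lemma cosh_gt_0 (x : R) : 0 < cosh x.
Proof. unfold cosh; generalize (exp_pos x) (exp_pos (- x)); lra. Qed.

(** Reduces comparisons of [cosh] to comparisons of [sinh], which is increasing, and produces the
    squares of [sinh] in the limiting denominator. *)
Lemma cosh_double (x : R) : cosh (2 * x) = 1 + 2 * sinh x ^ 2.
Proof.
  unfold cosh, sinh.
  replace (2 * x) with (x + x) by ring.
  replace (- (x + x)) with (- x + - x) by ring.
  rewrite !exp_plus, exp_Ropp.
  field; apply Rgt_not_eq, exp_pos.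
Qed.

Lemma cosh_gt_1 (x : R) : x <> 0 -> 1 < cosh x.
Proof.
  intros hx.
  replace x with (2 * (x / 2)) by field.
  rewrite cosh_double.
  assert (h : sinh (x / 2) <> 0).
  { destruct (Rtotal_order x 0) as [h | [h | h]]; [ | easy | ].
    - rewrite <- (Ropp_involutive (x / 2)), sinh_neg.
      generalize (sinh_gt_0 (- (x / 2))); lra.
    - generalize (sinh_gt_0 (x / 2)); lra. }
  generalize (pow2_gt_0 _ h); lra.
Qed.

Lemma sinh_neq_0 (x : R) : x <> 0 -> sinh x <> 0.
Proof.
  intros hx h.
  assert (h1 := cosh_gt_1 (2 * x) ltac:(lra)).
  rewrite cosh_double, h in h1; lra.
Qed.

Lemma cosh_lt (x y : R) : 0 < x -> x < y -> cosh x < cosh y.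
Proof.
  intros hx hxy.
  replace x with (2 * (x / 2)) by field.
  replace y with (2 * (y / 2)) by field.
  rewrite !cosh_double.
  assert (0 < sinh (x / 2)) by (apply sinh_gt_0; lra).
  assert (sinh (x / 2) < sinh (y / 2)) by (apply sinh_lt; lra).
  nra.
Qed.

(** The subtraction formula for [sinh] shows that [coth] decreases on the positive axis; so does
    [/ x], and both are positive there. This ordering decides which way the other phase escapes. *)
Lemma coth_div_decreasing (x y : R) :
  0 < x -> x < y -> coth y / y < coth x / x.
Proof.
  intros hx hxy.
  assert (hsx := sinh_gt_0 x hx).
  assert (hsy : 0 < sinh y) by (apply sinh_gt_0; lra).
  assert (hs : 0 < sinh (y - x)) by (apply sinh_gt_0; lra).
  assert (hcoth : coth x - coth y = sinh (y - x) / (sinh x * sinh y)).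
  { assert (h : sinh (y - x) = sinh y * cosh x - cosh y * sinh x).
    { unfold sinh, cosh.
      replace (- (y - x)) with (- y + x) by ring.
      unfold Rminus; rewrite !exp_plus; field. }
    unfold coth; rewrite h; field; lra. }
  assert (0 < sinh (y - x) / (sinh x * sinh y)).
  { apply Rdiv_lt_0_compat; [ | apply Rmult_lt_0_compat ]; assumption. }
  assert (0 < coth y) by (apply Rdiv_lt_0_compat; [ apply cosh_gt_0 | assumption ]).
  assert (/ y < / x) by (apply Rinv_lt_contravar; nra).
  assert (0 < / y) by (apply Rinv_0_lt_compat; lra).
  unfold Rdiv; nra.
Qed.

(** * Divergence of affine phases *)

Lemma is_lim_affine_p (a b : R) : 0 < b ->
  is_lim (fun t => a + b * t) p_infty p_infty.
Proof.
  intros hb; apply is_lim_spec; intros M; exists ((M - a) / b); intros t ht.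
  apply (Rmult_lt_compat_l b) in ht; [ | assumption ].
  replace (b * ((M - a) / b)) with (M - a) in ht by (field; lra).
  lra.
Qed.

Lemma is_lim_affine_m (a b : R) : b < 0 ->
  is_lim (fun t => a + b * t) m_infty p_infty.
Proof.
  intros hb; apply is_lim_spec; intros M; exists ((M - a) / b); intros t ht.
  apply (Rmult_lt_gt_compat_neg_l b) in ht; [ | assumption ].
  replace (b * ((M - a) / b)) with (M - a) in ht by (field; lra).
  lra.
Qed.

(** * Symmetries of the two-soliton formula *)

Lemma two_soliton_f_sym (k1 k2 l1 l2 : R) :
  two_soliton_f k1 k2 l1 l2 = two_soliton_f k2 k1 l2 l1.
Proof.
  unfold two_soliton_f.
  replace (l2 - l1) with (- (l1 - l2)) by ring.
  replace (2 * (k2 - k1)) with (- (2 * (k1 - k2))) by ring.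
  rewrite sinh_neg, cosh_neg, (Rplus_comm k2 k1), (Rplus_comm l2 l1).
  ring.
Qed.

Lemma two_soliton_g_sym (eps k1 k2 l1 l2 : R) :
  two_soliton_g eps k1 k2 l1 l2 = two_soliton_g eps k2 k1 l2 l1.
Proof. unfold two_soliton_g; ring. Qed.

Lemma two_soliton_sym (eps k1 k2 n t : R) :
  two_soliton eps k1 k2 n t = two_soliton eps k2 k1 n t.
Proof.
  unfold two_soliton.
  now rewrite two_soliton_f_sym, two_soliton_g_sym.
Qed.

Lemma two_soliton_f_opp (k1 k2 l1 l2 : R) :
  two_soliton_f k1 k2 (- l1) (- l2) = two_soliton_f k1 k2 l1 l2.
Proof.
  unfold two_soliton_f.
  replace (- l1 - - l2) with (- (l1 - l2)) by ring.
  replace (- l1 + - l2) with (- (l1 + l2)) by ring.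
  rewrite !Ropp_mult_distr_r_reverse, sinh_neg, !cosh_neg; ring.
Qed.

Lemma two_soliton_g_opp (eps k1 k2 l1 l2 : R) :
  two_soliton_g eps k1 k2 (- l1) (- l2) = two_soliton_g eps k1 k2 l1 l2.
Proof.
  unfold two_soliton_g.
  now rewrite !Ropp_mult_distr_r_reverse, !cosh_neg.
Qed.

(** * Limit in the frame of one soliton *)

(** After cancelling the growing exponential, the quotient is a rational function of
    [z = exp (- 2 m)], and [z] tends to 0. The limit is its value at 0, where the denominator is
    positive. *)
Lemma two_soliton_limit (eps k1 k2 l : R) (T : Rbar) (m : R -> R) :
  k1 + k2 <> 0 ->
  is_lim m T p_infty ->
  is_lim (fun t => two_soliton_g eps k1 k2 l (m t) / two_soliton_f k1 k2 l (m t)) T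
    (1 / eps * (cosh (2 * k1) - cosh (2 * k2)) * sinh (2 * k1)
     / (sinh (k1 + k2) ^ 2 * exp (- (2 * l)) + sinh (k1 - k2) ^ 2 * exp (2 * l))).
Proof.
  intros hk hm.
  set (w := exp (2 * l)).
  assert (hw : 0 < w) by apply exp_pos.
  set (C := 1 / eps * (cosh (2 * k1) - cosh (2 * k2))).
  (* [G] and [F] are [4 z g] and [4 z f] as polynomials in [z = exp (- 2 m)]. *)
  set (G := fun z : R =>
    C * (2 * sinh (2 * k1) * (1 + z * z) - 2 * sinh (2 * k2) * (w + / w) * z)).
  set (F := fun z : R =>
    cosh (2 * (k1 + k2)) * (/ w - 2 * z + w * (z * z))
    + cosh (2 * (k1 - k2)) * (w + 2 * z + / w * (z * z))
    - (w + / w) * (1 + z * z)).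
  assert (hF : F 0 = 2 * (sinh (k1 + k2) ^ 2 * / w + sinh (k1 - k2) ^ 2 * w)).
  (* The term [- (w + / w)] lowers each coefficient [cosh (2 x)] by 1, leaving [2 * sinh x ^ 2]. *)
  { unfold F; rewrite !cosh_double; ring. }
  assert (hpos : 0 < sinh (k1 + k2) ^ 2 * / w + sinh (k1 - k2) ^ 2 * w).
  { assert (0 < sinh (k1 + k2) ^ 2) by now apply pow2_gt_0, sinh_neq_0.
    assert (0 < / w) by now apply Rinv_0_lt_compat.
    assert (0 <= sinh (k1 - k2) ^ 2) by apply pow2_ge_0.
    apply Rplus_lt_le_0_compat;
      [ apply Rmult_lt_0_compat | apply Rmult_le_pos ]; lra. }
  apply is_lim_ext with (fun t => G (exp (- (2 * m t))) / F (exp (- (2 * m t)))).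
  { intros t.
    (* In terms of [x = exp l] and [y = exp (m t)] the claims on [F] and [G] are rational
       identities, with the coefficients depending on [k1] and [k2] kept opaque. *)
    set (y := exp (m t)).
    assert (hy : 0 < y) by apply exp_pos.
    set (x := exp l).
    assert (hx : 0 < x) by apply exp_pos.
    assert (hwx : w = x * x).
    { unfold w, x; rewrite <- exp_plus; f_equal; ring. }
    assert (hz : exp (- (2 * m t)) = / (y * y)).
    { unfold y; rewrite <- exp_plus, <- exp_Ropp; f_equal; ring. }
    rewrite hz.
    assert (hf : F (/ (y * y)) = 4 * / (y * y) * two_soliton_f k1 k2 l (m t)).
    { unfold F, two_soliton_f; rewrite hwx.
      generalize (cosh (2 * (k1 + k2))) (cosh (2 * (k1 - k2))); intros A B.
      unfold cosh, sinh.
      replace (- (l - m t)) with (- l + m t) by ring.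
      replace (- (l + m t)) with (- l + - m t) by ring.
      replace (2 * l) with (l + l) by ring.
      replace (2 * m t) with (m t + m t) by ring.
      replace (- (l + l)) with (- l + - l) by ring.
      replace (- (m t + m t)) with (- m t + - m t) by ring.
      unfold Rminus; rewrite !exp_plus, !exp_Ropp; fold x y.
      field; lra. }
    assert (hg : G (/ (y * y)) = 4 * / (y * y) * two_soliton_g eps k1 k2 l (m t)).
    { unfold G, two_soliton_g; fold C; rewrite hwx.
      generalize (sinh (2 * k1)) (sinh (2 * k2)) C; intros A B D.
      unfold cosh.
      replace (2 * l) with (l + l) by ring.
      replace (2 * m t) with (m t + m t) by ring.
      replace (- (l + l)) with (- l + - l) by ring.
      replace (- (m t + m t)) with (- m t + - m t) by ring.
      rewrite !exp_plus, !exp_Ropp; fold x y.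
      field; lra. }
    rewrite hf, hg.
    apply Rdiv_mult_l_l.
    apply Rgt_not_eq, Rmult_lt_0_compat; [ lra | ].
    apply Rinv_0_lt_compat, Rmult_lt_0_compat; assumption. }
  replace (C * sinh (2 * k1) / _) with (G 0 / F 0).
  2: { rewrite hF, exp_Ropp; fold w.
       replace (G 0) with (2 * (C * sinh (2 * k1))) by (unfold G; ring).
       apply Rdiv_mult_l_l; lra. }
  apply (is_lim_comp_continuous (fun t => exp (- (2 * m t))) (fun z => G z / F z)).
  - apply (is_lim_comp exp (fun t => - (2 * m t)) T 0 m_infty).
    + apply is_lim_exp_m.
    + apply (is_lim_opp (fun t => 2 * m t) T p_infty).
      rewrite <- (is_Rbar_mult_unique 2 p_infty p_infty).
      * now apply is_lim_scal_l.
      * apply is_Rbar_mult_sym, is_Rbar_mult_p_infty_pos; simpl; lra.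
    (* The inner function is real-valued, so it never equals its limit [m_infty]. *)
    + apply filter_forall; easy.
  - apply (ex_derive_continuous (fun z => G z / F z)).
    apply (ex_derive_div G F).
    + unfold G; auto_derive; easy.
    + unfold F; auto_derive; easy.
    + rewrite hF; lra.
Qed.

(** * From the limit to a soliton on its trace *)

Lemma unique_abs_max_sech (a c : R) : a <> 0 ->
  unique_abs_max_point (fun l => a / cosh (2 * (l - c))) c.
Proof.
  intros ha x hx.
  rewrite Rminus_diag, Rmult_0_r, cosh_0.
  assert (h : 1 < cosh (2 * (x - c))) by (apply cosh_gt_1; lra).
  unfold Rdiv.
  rewrite !Rabs_mult.
  apply Rmult_lt_compat_l; [ now apply Rabs_pos_lt | ].
  rewrite !Rabs_pos_eq.
  - apply Rinv_lt_contravar; lra.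
  - lra.
  - apply Rlt_le, Rinv_0_lt_compat; lra.
Qed.

Lemma lambda_site_at (eps k lam t : R) : k <> 0 ->
  lambda eps k (site_at eps k lam t) t = lam.
Proof. intros hk; unfold lambda, site_at; field; exact hk. Qed.

(** Isolates the drift of the other phase: for positive [eps] and [k'] its sign is that of
    [coth k' / k' - coth k / k]. *)
Lemma lambda_site_at_other (eps k k' lam t : R) : k <> 0 -> k' <> 0 ->
  lambda eps k' (site_at eps k lam t) t
  = k' / k * lam + eps * k' / 4 * (coth k' / k' - coth k / k) * t.
Proof. intros hk hk'; unfold lambda, site_at; field; split; assumption. Qed.

(* [s = 1] or [s = -1] is the sign of the infinity to which the phase of the
   other soliton, [k'], escapes. *)
Lemma asymptotic_soliton_of_escape (eps k k' s : R) (T : Rbar) (trace : R -> R) :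
  0 < eps -> 0 < k -> 0 < k' -> k <> k' -> s = 1 \/ s = -1 ->
  (forall lam, is_lim (fun t => s * lambda eps k' (site_at eps k lam t) t) T p_infty) ->
  (forall t, lambda eps k (trace t) t
     = - s / 2 * ln (Rabs (sinh (k' - k)) / sinh (k + k'))) ->
  asymptotic_soliton (two_soliton eps k k') eps k T trace
    (sinh (2 * k) * (cosh (2 * k) - cosh (2 * k'))
     / (2 * eps * Rabs (sinh (k' - k)) * sinh (k + k'))).
Proof.
  intros heps hk hk' hkk hs hesc htr.
  (* The absolute value covers both orders of [k] and [k']. *)
  set (q := Rabs (sinh (k' - k))) in *.
  set (p := sinh (k + k')) in *.
  set (a := _ / _).
  assert (hp : 0 < p) by (apply sinh_gt_0; lra).
  assert (hq : 0 < q) by (apply Rabs_pos_lt, sinh_neq_0; lra).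
  assert (ha : a <> 0).
  { assert (hs2 : sinh (2 * k) <> 0) by (apply sinh_neq_0; lra).
    assert (hc : cosh (2 * k) - cosh (2 * k') <> 0).
    { destruct (Rdichotomy _ _ hkk).
      - assert (cosh (2 * k) < cosh (2 * k')) by (apply cosh_lt; lra); lra.
      - assert (cosh (2 * k') < cosh (2 * k)) by (apply cosh_lt; lra); lra. }
    assert (hden : 2 * eps * q * p <> 0).
    { apply Rgt_not_eq, Rmult_lt_0_compat; [ | exact hp ].
      apply Rmult_lt_0_compat; [ lra | exact hq ]. }
    unfold a, Rdiv.
    apply Rmult_integral_contrapositive_currified.
    - now apply Rmult_integral_contrapositive_currified.
    - now apply Rinv_neq_0_compat. }
  (* With [E = exp (2 * (s * lam))], the limiting denominator [p ^ 2 / E + q ^ 2 * E] is least at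
     [E = p / q], that is at [lam = c]; it equals [2 * p * q * cosh (2 * (lam - c))]. *)
  set (c := - s / 2 * ln (q / p)) in *.
  exists (fun lam => a / cosh (2 * (lam - c))).
  split; [ now exists a, c | split ].
  - intros lam.
    (* Multiplying both phases by [s] changes neither [f] nor [g] and sends the other phase to
       [p_infty]. *)
    apply is_lim_ext with (fun t =>
      two_soliton_g eps k k' (s * lam) (s * lambda eps k' (site_at eps k lam t) t)
      / two_soliton_f k k' (s * lam) (s * lambda eps k' (site_at eps k lam t) t)).
    { intros t; unfold two_soliton.
      rewrite (lambda_site_at eps k lam t) by lra.
      destruct hs as [-> | ->].
      - now rewrite !Rmult_1_l.
      - replace (-1) with (- (1)) by ring.
        now rewrite !Ropp_mult_distr_l_reverse, !Rmult_1_l,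
          two_soliton_f_opp, two_soliton_g_opp. }
    replace (a / cosh (2 * (lam - c))) with
      (1 / eps * (cosh (2 * k) - cosh (2 * k')) * sinh (2 * k)
       / (sinh (k + k') ^ 2 * exp (- (2 * (s * lam)))
          + sinh (k - k') ^ 2 * exp (2 * (s * lam)))).
    { apply two_soliton_limit; [ lra | apply hesc ]. }
    assert (hq2 : sinh (k - k') ^ 2 = q ^ 2).
    { unfold q; rewrite pow2_abs.
      replace (k - k') with (- (k' - k)) by ring.
      rewrite sinh_neg; ring. }
    assert (hcosh : cosh (2 * (lam - c))
      = (q / p * exp (2 * (s * lam)) + p / q * exp (- (2 * (s * lam)))) / 2).
    { transitivity (cosh (ln (q / p) + 2 * (s * lam))).
      - unfold c; destruct hs as [-> | ->].
        + f_equal; field.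
        + rewrite <- cosh_neg; f_equal; field.
      - unfold cosh.
        rewrite Ropp_plus_distr, !exp_plus, (exp_Ropp (ln _)), exp_ln.
        + rewrite Rinv_div; reflexivity.
        + now apply Rdiv_lt_0_compat. }
    rewrite hq2, hcosh; fold p; unfold a.
    assert (hE := exp_pos (2 * (s * lam))).
    assert (hE' := exp_pos (- (2 * (s * lam)))).
    assert (0 < p ^ 2) by nra.
    assert (0 < q ^ 2) by nra.
    field; repeat split; nra.
  - intros t; rewrite htr; split.
    + now apply unique_abs_max_sech.
    + rewrite Rminus_diag, Rmult_0_r, cosh_0; field.
Qed.

(** * Speeds, and assembly of the four asymptotic regimes *)

Lemma has_speed_affine (c v : R) (trace : R -> R) :
  (forall t, trace t = c + v * t) -> has_speed trace v.
Proof.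
  intros h t.
  apply is_derive_ext with (fun t => c + v * t); [ now intros | ].
  auto_derive; [ easy | ring ].
Qed.

Lemma asymptotic_soliton_ext (u v : R -> R -> R) (eps k : R) (T : Rbar)
    (trace : R -> R) (a : R) :
  (forall n t, u n t = v n t) ->
  asymptotic_soliton u eps k T trace a -> asymptotic_soliton v eps k T trace a.
Proof.
  intros huv (P & hP & hlim & htr).
  exists P; split; [ exact hP | split; [ | exact htr ] ].
  intros lam; apply is_lim_ext with (2 := hlim lam); intros t; apply huv.
Qed.

Theorem theorem4 (k1 k2 eps : R) (hk1 : 0 < k1) (hk12 : k1 < k2)
    (heps : 0 < eps) :
  let mu := two_soliton eps k1 k2 in
  let L := ln (sinh (k2 - k1) / sinh (k1 + k2)) in
  (let trace_out := fun t : R => 1 / (2 * k1) * L - eps * coth k1 / (4 * k1) * t in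
   let trace_in := fun t : R => - (1 / (2 * k1) * L) - eps * coth k1 / (4 * k1) * t in
   let amplitude :=
     sinh (2 * k1) * (cosh (2 * k1) - cosh (2 * k2))
     / (2 * eps * sinh (k2 - k1) * sinh (k1 + k2)) in
   let speed := - (eps / (4 * k1)) * coth k1 in
   asymptotic_soliton mu eps k1 p_infty trace_out amplitude /\
   asymptotic_soliton mu eps k1 m_infty trace_in amplitude /\
   has_speed trace_out speed /\
   has_speed trace_in speed /\
   phase_shift trace_out trace_in = 1 / k1 * L)
  /\
  (let trace_out := fun t : R => - (1 / (2 * k2) * L) - eps * coth k2 / (4 * k2) * t in
   let trace_in := fun t : R => 1 / (2 * k2) * L - eps * coth k2 / (4 * k2) * t in
   let amplitude :=
     sinh (2 * k2) * (cosh (2 * k2) - cosh (2 * k1))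
     / (2 * eps * sinh (k2 - k1) * sinh (k1 + k2)) in
   let speed := - (eps / (4 * k2)) * coth k2 in
   asymptotic_soliton mu eps k2 p_infty trace_out amplitude /\
   asymptotic_soliton mu eps k2 m_infty trace_in amplitude /\
   has_speed trace_out speed /\
   has_speed trace_in speed /\
   phase_shift trace_out trace_in = - (1 / k2) * L).
Proof.
  assert (hd := coth_div_decreasing k1 k2 hk1 hk12).
  assert (hsm : 0 < sinh (k2 - k1)) by (apply sinh_gt_0; lra).
  assert (habs1 : Rabs (sinh (k2 - k1)) = sinh (k2 - k1)) by (apply Rabs_pos_eq; lra).
  assert (habs2 : Rabs (sinh (k1 - k2)) = sinh (k2 - k1)).
  { replace (k1 - k2) with (- (k2 - k1)) by ring.
    now rewrite sinh_neg, Rabs_Ropp. }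
  (* [b1] is the slope in [t] of the second phase with the first held fixed, and [b2] that of the
     first with the second held fixed. Their signs fix [s] in each case below. *)
  set (b1 := eps * k2 / 4 * (coth k2 / k2 - coth k1 / k1)).
  assert (hb1 : b1 < 0).
  { apply Rmult_pos_neg; [ | lra ].
    assert (0 < eps * k2) by (apply Rmult_lt_0_compat; lra); lra. }
  set (b2 := eps * k1 / 4 * (coth k1 / k1 - coth k2 / k2)).
  assert (hb2 : 0 < b2).
  { apply Rmult_lt_0_compat; [ | lra ].
    assert (0 < eps * k1) by (apply Rmult_lt_0_compat; lra); lra. }
  intros mu L.
  split; intros trace_out trace_in amplitude speed;
    (split; [ | split; [ | split; [ | split ] ] ]).
  - unfold amplitude; rewrite <- habs1.
    apply asymptotic_soliton_of_escape with (s := -1); try lra.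
    + intros lam.
      apply is_lim_ext with (fun t => - (k2 / k1 * lam) + - b1 * t).
      * intros t; rewrite lambda_site_at_other by lra; unfold b1; ring.
      * apply is_lim_affine_p; lra.
    + intros t; rewrite habs1; fold L; unfold lambda, trace_out; field; lra.
  - unfold amplitude; rewrite <- habs1.
    apply asymptotic_soliton_of_escape with (s := 1); try lra.
    + intros lam.
      apply is_lim_ext with (fun t => k2 / k1 * lam + b1 * t).
      * intros t; rewrite lambda_site_at_other by lra; unfold b1; ring.
      * apply is_lim_affine_m; lra.
    + intros t; rewrite habs1; fold L; unfold lambda, trace_in; field; lra.
  - apply has_speed_affine with (1 / (2 * k1) * L).
    intros t; unfold trace_out, speed; field; lra.
  - apply has_speed_affine with (- (1 / (2 * k1) * L)).
    intros t; unfold trace_in, speed; field; lra.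
  - unfold phase_shift, trace_out, trace_in; field; lra.
  (* Exchanging the solitons makes [k2] the parameter of the frame; the absolute value [habs2] then
     yields the same logarithm [L]. *)
  - apply (asymptotic_soliton_ext _ _ _ _ _ _ _ (two_soliton_sym eps k2 k1)).
    unfold amplitude; rewrite <- habs2, (Rplus_comm k1 k2).
    apply asymptotic_soliton_of_escape with (s := 1); try lra.
    + intros lam.
      apply is_lim_ext with (fun t => k1 / k2 * lam + b2 * t).
      * intros t; rewrite lambda_site_at_other by lra; unfold b2; ring.
      * apply is_lim_affine_p; lra.
    + intros t; rewrite habs2, (Rplus_comm k2 k1); fold L.
      unfold lambda, trace_out; field; lra.
  - apply (asymptotic_soliton_ext _ _ _ _ _ _ _ (two_soliton_sym eps k2 k1)).
    unfold amplitude; rewrite <- habs2, (Rplus_comm k1 k2).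
    apply asymptotic_soliton_of_escape with (s := -1); try lra.
    + intros lam.
      apply is_lim_ext with (fun t => - (k1 / k2 * lam) + - b2 * t).
      * intros t; rewrite lambda_site_at_other by lra; unfold b2; ring.
      * apply is_lim_affine_m; lra.
    + intros t; rewrite habs2, (Rplus_comm k2 k1); fold L.
      unfold lambda, trace_in; field; lra.
  - apply has_speed_affine with (- (1 / (2 * k2) * L)).
    intros t; unfold trace_out, speed; field; lra.
  - apply has_speed_affine with (1 / (2 * k2) * L).
    intros t; unfold trace_in, speed; field; lra.
  - unfold phase_shift, trace_out, trace_in; field; lra.
Qed.
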